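(* There is an absolute constant $C>0$ such that the following holds. Let $\rho>0$, let $\mathcal{K}\subset\mathbb{R}^d$ be a compact $\rho$-smooth convex body with $\operatorname{diam}(\mathcal{K})\le D$, and let $f$ be $\beta$-smooth and $\alpha$-strongly convex on $\mathcal{K}$ ($\alpha,\beta>0$). Let $x^\star\in\arg\min_{x\in\mathcal{K}}f(x)$ and $f^\star:=f(x^\star)$. Let $x_0\in\mathcal{K}$ and suppose that $$f(x_0)-f^\star\le H_0,\qquad \sup_{x\in\mathcal{K}}\|\nabla f(x)\|\le G.$$ Define $\gamma:=\alpha/\beta$ and $\Gamma:=G/(\alpha\rho)$. Then for every $0<\varepsilon<H_0$ there is an integer $T$ with $$1\le T\le\Big\lceil C\,(\gamma^{-1}+\Gamma)\log\frac{H_0}{\varepsilon}\Big\rceil$$ such that the shrinking-radius one-tangent method (defined in the context), started at $x_0$ and run for $T$ iterations with exact tangent access, returns $x_T\in\mathcal{K}$ satisfying $f(x_T)-f^\star\le\varepsilon$. Each iteration uses one objective gradient and at most one exact tangent query.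
   Context: $\|\cdot\|$ and $\langle\cdot,\cdot\rangle$ are the Euclidean norm and inner product on $\mathbb{R}^d$; $\mathbb{B}(x,s)$ is the closed Euclidean ball of radius $s$ centered at $x$; $\operatorname{proj}_S$ is Euclidean projection onto a closed convex set $S$. A convex body is a compact convex set with nonempty interior. $\rho$-smooth set: a convex body $\mathcal{K}$ is $\rho$-smooth if for every $q\in\partial\mathcal{K}$ and every outward supporting unit normal $n$ at $q$ (a unit vector with $\langle n,z-q\rangle\le 0$ for all $z\in\mathcal{K}$) one has $\mathbb{B}(q-\rho n,\rho)\subseteq\mathcal{K}$. Conventions on $f$: $f$ is differentiable on a neighborhood of $\mathcal{K}$; $\beta$-smooth on $\mathcal{K}$ means $\nabla f$ is $\beta$-Lipschitz on $\mathcal{K}$; $\alpha$-strongly convex on $\mathcal{K}$ means $f(y)\ge f(x)+\langle\nabla f(x),y-x\rangle+\frac{\alpha}{2}\|y-x\|^2$ for all $x,y\in\mathcal{K}$. Exact tangent query: given $x\in\mathcal{K}$ and $y\in\mathbb{R}^d$, one query returns the last point $q\in[x,y]\cap\mathcal{K}$ (the point of $[x,y]\cap\mathcal{K}$ farthest from $x$). If $q=y$ this certifies $y\in\mathcal{K}$; otherwise the query also returns an outward supporting unit normal $n$ to $\mathcal{K}$ at $q$. One-tangent local oracle: given $x\in\mathcal{K}$, $0<s\le D$ and $c\in\mathbb{R}^d$, if $c=0$ return $x$. Otherwise query the endpoint $x-s\,c/\|c\|$ and write the returned point as $q=x-\tau c/\|c\|$, $0\le\tau\le s$. If $\tau=s$,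 return $q$. Otherwise let $n$ be the returned outward unit normal at $q$, compute any $p\in\arg\min\{\langle c,z\rangle: z\in\mathbb{B}(x,s),\ \langle n,z-q\rangle\le 0\}$, and return $\operatorname{proj}_{\mathbb{B}(q-\rho n,\rho)}(p)$. Shrinking-radius one-tangent method: let $\kappa=\beta/\alpha$, $a=2/\rho$, $b=aG/\alpha$, $\theta=\frac{1}{4(1+b)}$, $\eta=\frac{1+b}{1+b+\kappa}$, $\sigma=\frac{1}{16(1+b+\kappa)}$, $\Delta_t=(1-\sigma)^tH_0$, and $s_t=\min\{D,\ \theta\sqrt{2\Delta_t/\alpha}\}$. For $t=0,1,2,\dots$: let $p_t$ be the output of the one-tangent local oracle on input $(x_t,s_t,\nabla f(x_t))$ and set $x_{t+1}=x_t+\eta(p_t-x_t)$. *)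

(* Defs.v *)
From HB Require Import structures.
From mathcomp Require Import all_boot all_order all_algebra.
From mathcomp Require Import all_classical all_reals all_analysis.

Set Implicit Arguments.
Unset Strict Implicit.
Unset Printing Implicit Defensive.

Import Order.TTheory GRing.Theory Num.Theory.
Import numFieldNormedType.Exports.

Local Open Scope classical_set_scope.
Local Open Scope ring_scope.

(** The library norm on ['rV[R]_d] is the sup norm; it is used here only through
    the topology and the notion of differentiability it induces, which are the
    same as for the Euclidean norm.  Lengths are measured with [enorm]. *)
Section Euclidean.
Variables (R : realType) (d : nat).
Local Notation V := 'rV[R]_d.
Implicit Types (u v x y q n : V) (K S : set V) (f : V -> R).

Definition dot u v : R := \sum_(i < d) u 0 i * v 0 i.

Definition enorm u : R := Num.sqrt (dot u u).

Definition eball x (r : R) : set V := closed_ball_ enorm x r.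

Definition segment x y : set V :=
  [set (1 - t) *: x + t *: y | t in `[0, 1]%classic].

Definition boundary K : set V := closure K `\` K°.

(** Valued in [\bar R], so that an unbounded set does not get a junk value. *)
Definition diam K : \bar R :=
  ereal_sup [set (enorm (p.1 - p.2))%:E | p in K `*` K].

Definition argmin S (g : V -> R) : set V :=
  [set z | S z /\ forall w, S w -> g z <= g w].

(** The nearest point, which is unique when [S] is nonempty, closed and convex. *)
Definition proj S x : V := xget 0 (argmin S (fun z => enorm (x - z))).

Definition convex_body K : Prop :=
  [/\ compact K, convex_set (K : set (convex_lmodType V)) & K° !=set0].

Definition outward_unit_normal K q n : Prop :=
  enorm n = 1 /\ forall z, K z -> dot n (z - q) <= 0.

Definition smooth_body (rho : R) K : Prop :=
  convex_body K /\
  forall q n, boundary K q -> outward_unit_normal K q n ->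
    eball (q - rho *: n) rho `<=` K.

Definition grad f x : V := \row_(i < d) 'D_(delta_mx 0 i) f x.

Definition differentiable_near f K : Prop :=
  exists U : set V, [/\ open U, K `<=` U & forall x, U x -> differentiable f x].

Definition smooth_on (beta : R) K f : Prop :=
  forall x y, K x -> K y ->
    enorm (grad f x - grad f y) <= beta * enorm (x - y).

Definition strongly_convex_on (alpha : R) K f : Prop :=
  forall x y, K x -> K y ->
    f x + dot (grad f x) (y - x) + alpha / 2 * enorm (y - x) ^+ 2 <= f y.

End Euclidean.

(** A program over the points of [V] that may ask for a gradient and issue tangent
    queries.  A tangent query from [x] to [y] is answered by a pair [(q, n)],
    where [n] is meaningful only if [q != y]. *)
Inductive program (V A : Type) : Type :=
| Return of A
| Gradient of V & (V -> program V A)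
| Tangent of V & V & (V * V -> program V A).

Fixpoint bind (V A B : Type) (m : program V A) (h : A -> program V B) :
    program V B :=
  match m with
  | Return a => h a
  | Gradient x k => Gradient x (fun g => bind (k g) h)
  | Tangent x y k => Tangent x y (fun a => bind (k a) h)
  end.

Record outcome (A : Type) : Type := Outcome {
  result : A;
  gradient_count : nat;
  tangent_count : nat
}.

Fixpoint run (V A : Type) (gradient : V -> V) (tangent : V -> V -> V * V)
    (m : program V A) : outcome A :=
  match m with
  | Return a => Outcome a 0 0
  | Gradient x k =>
      let: Outcome a ng nt := run gradient tangent (k (gradient x)) in
      Outcome a ng.+1 nt
  | Tangent x y k =>
      let: Outcome a ng nt := run gradient tangent (k (tangent x y)) in
      Outcome a ng nt.+1
  end.

Section Oracles.
Variables (R : realType) (d : nat).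
Local Notation V := 'rV[R]_d.

Definition last_point (K : set V) (x y q : V) : Prop :=
  (segment x y `&` K) q /\
  forall z, (segment x y `&` K) z -> enorm (z - x) <= enorm (q - x).

Definition exact_tangent (K : set V) (tangent : V -> V -> V * V) : Prop :=
  forall x y, K x ->
    last_point K x y (tangent x y).1 /\
    ((tangent x y).1 <> y ->
     outward_unit_normal K (tangent x y).1 (tangent x y).2).

(** [lmo c S] is some minimizer of [<c, .>] over [S], whenever there is one. *)
Definition linear_minimizer (lmo : V -> set V -> V) : Prop :=
  forall c S, argmin S (dot c) !=set0 -> argmin S (dot c) (lmo c S).

(** Since [q = x - tau c / |c|] with [0 <= tau], [tau] is recovered as [|q - x|]. *)
Definition local_oracle (rho : R) (lmo : V -> set V -> V) (x : V) (s : R)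
    (c : V) : program V V :=
  if c == 0 then Return V x else
  Tangent x (x - (s / enorm c) *: c) (fun '(q, n) =>
    let tau := enorm (q - x) in
    if tau == s then Return V q else
    let p := lmo c (eball x s `&` [set z | dot n (z - q) <= 0]) in
    Return V (proj (eball (q - rho *: n) rho) p)).

End Oracles.

Section Method.
Variables (R : realType) (d : nat).
Local Notation V := 'rV[R]_d.
Variables (alpha beta rho G D H0 : R).

Let kappa := beta / alpha.
Let a := 2 / rho.
Let b := a * G / alpha.

Definition theta : R := 1 / (4 * (1 + b)).
Definition eta : R := (1 + b) / (1 + b + kappa).
Definition sigma : R := 1 / (16 * (1 + b + kappa)).
Definition Delta (t : nat) : R := (1 - sigma) ^+ t * H0.
Definition radius (t : nat) : R :=
  Num.min D (theta * Num.sqrt (2 * Delta t / alpha)).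

Definition iteration (lmo : V -> set V -> V) (t : nat) (x : V) : program V V :=
  Gradient x (fun c =>
    bind (local_oracle rho lmo x (radius t) c) (fun p =>
      Return V (x + eta *: (p - x)))).

(** The oracles are indexed by the iteration: an answer may depend on the time of
    the query and not only on its input.  As an iteration calls each of them at
    most once, this covers every admissible sequence of answers. *)
Variables (f : V -> R) (tangent : nat -> V -> V -> V * V)
  (lmo : nat -> V -> set V -> V) (x0 : V).

Fixpoint iterate (t : nat) : V :=
  if t is t'.+1 then
    result (run (grad f) (tangent t') (iteration (lmo t') t' (iterate t')))
  else x0.

Definition iteration_outcome (t : nat) : outcome V :=
  run (grad f) (tangent t) (iteration (lmo t) t (iterate t)).

End Method.

(* Main.v *)
Require Import Defs.
From HB Require Import structures.
From mathcomp Require Import all_boot all_order all_algebra.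
From mathcomp Require Import all_classical all_reals all_analysis.
From mathcomp Require Import ring lra.

Set Implicit Arguments.
Unset Strict Implicit.
Unset Printing Implicit Defensive.

Import Order.TTheory GRing.Theory Num.Theory.
Import numFieldNormedType.Exports.

Local Open Scope classical_set_scope.
Local Open Scope ring_scope.

(** Let [h = f x - f*] and [s = radius t].  The segment from [x] to [x*] contains
    the point [x + theta (x* - x)], which lies within [s] of [x] because strong
    convexity gives [|x - x*| <= sqrt (2 h / alpha)].  The half-space returned by the
    tangent query contains [K], so the linear minimizer over its intersection with
    the ball of radius [s] does at least as well as that point; the inner ball of
    radius [rho] touches this half-space to second order, so projecting onto it
    costs only [G s^2 / (2 rho)].  The descent inequality then contracts the gap by
    [1 - sigma].  If [beta < alpha], then [K] is a single point; otherwise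
    [1 <= beta / alpha] absorbs the constant term of [1 / sigma]. *)

(** * Euclidean geometry: inner product, compact balls, projection onto a ball *)

Section InnerProduct.
Variables (R : realType) (d : nat).
Local Notation V := 'rV[R]_d.
Implicit Types (u v w x y z c : V) (r t : R).

Lemma dotC u v : dot u v = dot v u.
Proof. by apply: eq_bigr => i _; rewrite mulrC. Qed.

Lemma dotDl u v w : dot (u + v) w = dot u w + dot v w.
Proof. by rewrite -big_split; apply: eq_bigr => i _; rewrite mxE mulrDl. Qed.

Lemma dotZl r u v : dot (r *: u) v = r * dot u v.
Proof. by rewrite [RHS]mulr_sumr; apply: eq_bigr => i _; rewrite mxE mulrA. Qed.

Lemma dotNl u v : dot (- u) v = - dot u v.
Proof. by rewrite -scaleN1r dotZl mulN1r. Qed.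

Lemma dotDr u v w : dot w (u + v) = dot w u + dot w v.
Proof. by rewrite dotC dotDl !(dotC w). Qed.

Lemma dotZr r u v : dot v (r *: u) = r * dot v u.
Proof. by rewrite dotC dotZl dotC. Qed.

Lemma dotNr u v : dot v (- u) = - dot v u.
Proof. by rewrite dotC dotNl dotC. Qed.

Definition dotE := (dotDl, dotDr, dotNl, dotNr, dotZl, dotZr).

Lemma dot_ge0 u : 0 <= dot u u.
Proof. by apply: sumr_ge0 => i _; rewrite -expr2 sqr_ge0. Qed.

Lemma dot_eq0 u : dot u u = 0 -> u = 0.
Proof.
move=> /eqP; rewrite psumr_eq0 => [/allP u0|i _]; last by rewrite -expr2 sqr_ge0.
apply/rowP => i; rewrite mxE.
by have := u0 i (mem_index_enum _); rewrite /= mulf_eq0 orbb => /eqP.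
Qed.

Lemma enorm_ge0 u : 0 <= enorm u.
Proof. exact: sqrtr_ge0. Qed.

Lemma enorm_sqr u : enorm u ^+ 2 = dot u u.
Proof. by rewrite sqr_sqrtr// dot_ge0. Qed.

Lemma enorm_le u r : 0 <= r -> (enorm u <= r) = (dot u u <= r ^+ 2).
Proof. by move=> r0; rewrite -enorm_sqr ler_pXn2r// nnegrE ?enorm_ge0. Qed.

Lemma enorm_gt0 u : u != 0 -> 0 < enorm u.
Proof.
move=> u0; rewrite lt_def enorm_ge0 andbT; apply: contra_neq u0 => e0.
by apply: dot_eq0; rewrite -enorm_sqr e0 expr0n.
Qed.

Lemma enormN u : enorm (- u) = enorm u.
Proof. by rewrite /enorm dotNl dotNr opprK. Qed.

Lemma enormB u v : enorm (u - v) = enorm (v - u).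
Proof. by rewrite -enormN opprB. Qed.

Lemma enormZ r u : 0 <= r -> enorm (r *: u) = r * enorm u.
Proof.
move=> r0; rewrite /enorm dotZl dotZr mulrA -expr2 sqrtrM ?sqr_ge0//.
by rewrite sqrtr_sqr ger0_norm.
Qed.

Lemma cauchy_schwarz u v : dot u v <= enorm u * enorm v.
Proof.
have [->|v0] := eqVneq v 0.
  by rewrite -(scale0r 0) dotZr mul0r mulr_ge0// enorm_ge0.
have nv : 0 < dot v v by rewrite -enorm_sqr exprn_gt0// enorm_gt0.
have [uv|uv] := leP (dot u v) 0.
  by apply: le_trans uv _; rewrite mulr_ge0// enorm_ge0.
have : 0 <= dot v v * (dot u u * dot v v - dot u v ^+ 2).
  have := dot_ge0 (dot v v *: u - dot u v *: v).
  rewrite !dotE (dotC v u); lra.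
rewrite pmulr_rge0// -!enorm_sqr -exprMn subr_ge0.
by rewrite ler_pXn2r// nnegrE ?mulr_ge0 ?enorm_ge0 ?ltW.
Qed.

Lemma dot_continuous u : continuous (dot u : V -> R).
Proof.
have -> : dot u = \sum_(i < d) (fun v : V => u 0 i * v 0 i).
  by apply/funext => v; rewrite fct_sumE.
elim/big_rec: _ => [|i g _ gc] z; first exact: (@cst_continuous V R 0 z).
by apply: cvgD (gc z); apply: cvgM; [exact: cvg_cst|exact: coord_continuous].
Qed.

Lemma enorm_continuous : continuous (@enorm R d).
Proof.
move=> z; apply: continuous_comp; last exact: sqrt_continuous.
have -> : (fun v => dot v v) = \sum_(i < d) (fun v : V => v 0 i * v 0 i).
  by apply/funext => v; rewrite fct_sumE.
elim/big_rec: _ => [|i g _ gc]; first exact: (@cst_continuous V R 0 z).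
by apply: cvgD gc; apply: cvgM; exact: coord_continuous.
Qed.

Lemma enormB_continuous x : continuous (fun z => enorm (x - z)).
Proof.
move=> z; apply: continuous_comp; last exact: enorm_continuous.
apply: (@continuousB _ _ _ (cst x) id); first exact: cst_continuous.
exact: cvg_id.
Qed.

Lemma eball_closed x r : closed (eball x r).
Proof.
apply: (@preimage_closed _ _ (fun z => enorm (x - z)) [set s | s <= r]).
  by move=> z _; exact: enormB_continuous.
exact: closed_le.
Qed.

(** Each coordinate is bounded by the Euclidean length, so the ball is a closed subset of a product
    of compact intervals. *)
Lemma eball_compact x r : compact (eball x r).
Proof.
apply: (subclosed_compact (@eball_closed x r)).
  apply: (@rV_compact _ _ (fun i => `[x 0 i - r, x 0 i + r]%classic)) => i.
  exact: segment_compact.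
move=> z xz i /=; have r0 := le_trans (enorm_ge0 _) xz.
move: xz; rewrite /eball /closed_ball_ /= enorm_le// => xz.
have : (x 0 i - z 0 i) ^+ 2 <= r ^+ 2.
  apply: le_trans xz; rewrite /dot (bigD1 i)//= !mxE -expr2 lerDl.
  by apply: sumr_ge0 => j _; rewrite -expr2 sqr_ge0.
by rewrite in_itv/= => xzr; apply/andP; split; nra.
Qed.

Lemma compact_argmin (S : set V) (g : V -> R) :
  S !=set0 -> compact S -> continuous g -> argmin S g !=set0.
Proof.
move=> S0 cS cg.
have [z zS zmin] := EVT_min_rV S0 cS (continuous_subspaceT cg).
by exists z; split => [|w Sw]; [rewrite inE in zS|apply: zmin; rewrite inE].
Qed.

(** Convexity in the form [x + t *: (y - x)], which is the shape of the update step and takes a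
    plain real [t]. *)
Definition segment_closed (S : set V) : Prop :=
  forall x y t, S x -> S y -> 0 <= t <= 1 -> S (x + t *: (y - x)).

Lemma convex_segment (S : set V) :
  convex_set (S : set (convex_lmodType V)) -> segment_closed S.
Proof.
move=> cS x y t Sx Sy /andP[t0 t1].
have := cS y x (Itv01 t0 t1); rewrite !inE => /(_ Sy Sx).
rewrite [X in S X -> _](_ : _ = t *: y + (1 - t) *: x)//.
by rewrite scalerBl scale1r scalerBr addrCA addrA addrC.
Qed.

Lemma eball_segment x r : segment_closed (eball x r).
Proof.
move=> y z t; rewrite /eball /closed_ball_ /= => xy xz /andP[t0 t1].
have r0 := le_trans (enorm_ge0 _) xy.
have -> : x - (y + t *: (z - y)) = (1 - t) *: (x - y) + t *: (x - z).
  by apply/rowP => i; rewrite !mxE; ring.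
move: xy xz; rewrite !enorm_le//; move: (x - y) (x - z) => u v uu vv.
(* The term [t (1 - t) |u - v|^2] is exactly the convexity defect of the squared length. *)
have := mulr_ge0 (mulr_ge0 t0 (ltac:(lra) : 0 <= 1 - t)) (dot_ge0 (u - v)).
rewrite !dotE (dotC v u); nra.
Qed.

(** Stands in for the limit [t -> 0] in first-order arguments, where dividing by [t] leaves a factor
    [1 - t]. *)
Lemma le_of_scaled (m e : R) :
  (forall t, 0 < t < 1 -> (1 - t) * m <= e) -> m <= e.
Proof.
move=> h; rewrite leNgt; apply/negP => em.
have := h 2^-1 ltac:(lra) => hm.
have m0 : 0 < m by lra.
(* For this [t], [(1 - t) * m] is the midpoint of [e] and [m], hence still above [e]. *)
have := h ((m - e) / (2 * m)).
rewrite divr_gt0 ?subr_gt0 ?mulr_gt0//= ltr_pdivrMr ?mulr_gt0// => /(_ ltac:(lra)).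
rewrite (_ : (1 - _) * m = (m + e) / 2); first lra.
by field; lra.
Qed.

(** The angle at [p] between [w] and any [z] of the ball is not acute: compare [p] with
    [p + t *: (z - p)] and let [t] tend to 0. *)
Lemma ball_projection x r w (p := Defs.proj (eball x r) w) : 0 <= r ->
  eball x r p /\ forall z, eball x r z ->
    enorm (z - p) ^+ 2 <= enorm (w - z) ^+ 2 - enorm (w - p) ^+ 2.
Proof.
move=> r0.
have : argmin (eball x r) (fun z => enorm (w - z)) p.
  have [|z] := @compact_argmin (eball x r) (fun z => enorm (w - z)) _
                 (@eball_compact x r) (@enormB_continuous w).
    exists x; rewrite /eball /closed_ball_ /= enorm_le//.
    by rewrite subrr -(scale0r 0) dotZl mul0r sqr_ge0.
  (* Compactness provides a nearest point, so [proj] does not take its default value. *)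
  exact: xgetI.
move=> [pB pmin]; split=> // z zB; apply: le_of_scaled => t /andP[t0 t1].
have := pmin _ (eball_segment pB zB (t:=t) ltac:(lra)).
rewrite enorm_le ?enorm_ge0// !enorm_sqr.
have -> : w - (p + t *: (z - p)) = w - p - t *: (z - p) by rewrite opprD addrA.
have -> : w - z = w - p - (z - p) by rewrite opprB addrA subrK.
move: (w - p) (z - p) => u v.
rewrite !dotE (dotC v u) => pmin_t; rewrite -(ler_pM2l t0); lra.
Qed.

End InnerProduct.

(** * Consequences of strong convexity and smoothness along segments *)

Section FirstOrder.
Variables (R : realType) (d : nat) (K : set 'rV[R]_d) (f : 'rV[R]_d -> R).
Hypothesis segmentK : segment_closed K.

(** Strong convexity is applied at a point [z] of the segment, towards both ends, with weights [t]
    and [1 - t]. The gradient terms cancel, and [f z] is at least the minimum. *)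
Lemma strongly_convex_growth alpha xstar x :
  strongly_convex_on alpha K f -> argmin K f xstar -> K x ->
  alpha / 2 * enorm (x - xstar) ^+ 2 <= f x - f xstar.
Proof.
move=> fconv [Kxs fmin] Kx; apply: le_of_scaled => t t01.
have Kz := segmentK Kxs Kx (t := t) ltac:(lra).
have := fconv _ _ Kz Kx; have := fconv _ _ Kz Kxs; have := fmin _ Kz.
set z := xstar + _.
have -> : x - z = (1 - t) *: (x - xstar).
  by apply/rowP => i; rewrite !mxE; ring.
have -> : xstar - z = - t *: (x - xstar).
  by apply/rowP => i; rewrite !mxE; ring.
rewrite !enorm_sqr !dotZl !dotZr; move: (x - xstar) => v.
have /andP[t0 t1] := t01 => zmin hxs hx.
rewrite -(ler_pM2l t0).
have := ler_wpM2l (ltW t0) hx.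
have := ler_wpM2l (ltac:(lra) : 0 <= 1 - t) hxs.
by move: zmin; clear; lra.
Qed.

Lemma smooth_gradient_dot beta x y : smooth_on beta K f -> K x -> K y ->
  dot (grad f y - grad f x) (y - x) <= beta * enorm (y - x) ^+ 2.
Proof.
move=> fsmooth Kx Ky; apply: le_trans (cauchy_schwarz _ _) _.
by rewrite expr2 mulrA ler_wpM2r ?enorm_ge0 ?fsmooth.
Qed.

(** Adding strong convexity in both directions bounds [alpha |x - y|^2] by the gradient variation,
    itself at most [beta |x - y|^2]. *)
Lemma singleton_of_conditioning alpha beta x y :
  strongly_convex_on alpha K f -> smooth_on beta K f -> beta < alpha ->
  K x -> K y -> x = y.
Proof.
move=> fconv fsmooth ba Kx Ky; apply/eqP; rewrite -subr_eq0; apply/eqP.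
apply: dot_eq0; apply: le_anti; rewrite dot_ge0 andbT.
have := fconv _ _ Kx Ky; have := fconv _ _ Ky Kx.
have := smooth_gradient_dot fsmooth Ky Kx.
rewrite (enormB y) !enorm_sqr -(opprB x y) !dotNr.
by move: (x - y) => v; rewrite dotDl dotNl; have := dot_ge0 v; nra.
Qed.

(* Convexity at [y] gives the constant [beta], and passing through the midpoint
   halves the excess over [beta / 2]. *)
Lemma smooth_descent alpha beta k x y : 0 <= alpha ->
  strongly_convex_on alpha K f -> smooth_on beta K f -> K x -> K y ->
  f y <= f x + dot (grad f x) (y - x)
         + beta / 2 * (1 + 2^-1 ^+ k) * enorm (y - x) ^+ 2.
Proof.
move=> a0 fconv fsmooth; elim: k x y => [|k IHk] x y Kx Ky.
  have := smooth_gradient_dot fsmooth Kx Ky; have := fconv _ _ Ky Kx.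
  rewrite (enormB x) !enorm_sqr -(opprB y x) !dotNr expr0.
  move: (y - x) => v; rewrite dotDl dotNl.
  by have := mulr_ge0 a0 (dot_ge0 v); lra.
have Km := segmentK Kx Ky (t := 2^-1) ltac:(lra).
(* Each half step contributes a quarter of the current constant [c], and the gradient change at [m]
   adds [beta / 4]: [c] becomes [c / 2 + beta / 4], with fixed point [beta / 2]. *)
have := IHk _ _ Km Ky; have := IHk _ _ Kx Km.
have := smooth_gradient_dot fsmooth Kx Km.
set m := x + _.
have -> : y - m = 2^-1 *: (y - x).
  by apply/rowP => i; rewrite !mxE; field.
have -> : m - x = 2^-1 *: (y - x) by rewrite /m addrC addKr.
rewrite !enorm_sqr !dotZl !dotZr exprS.
by move: (y - x) => v; rewrite dotDl dotNl; lra.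
Qed.

End FirstOrder.

(** * Accuracy of the one-tangent local oracle *)

Section LocalOracle.
Variables (R : realType) (d : nat).
Implicit Types (x c q n : 'rV[R]_d) (K : set 'rV[R]_d).

(** From an interior point one could move a little along [n] inside [K], against the supporting
    inequality. This makes the inner-ball property available at [q]. *)
Lemma outward_normal_boundary K q n :
  K q -> outward_unit_normal K q n -> boundary K q.
Proof.
move=> Kq [n1 nK]; split; first exact: subset_closure.
move=> Kq_int.
have nearK : \forall t \near (0 : R), K (q + t *: n).
  have line : (fun t : R => q + t *: n) @ (0 : R) --> q.
    rewrite -[X in _ --> X]addr0 -(scale0r n).
    apply: cvgD; first exact: cvg_cst.
    by apply: cvgZr_tmp; exact: cvg_id.
  exact: line.
have nearK_right : \forall t \near 0^'+, K (q + t *: n).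
  exact: cvg_within nearK.
have [t [t0 Kt]] := filter_ex (filterI (nbhs_right_gt 0) nearK_right).
have := nK _ Kt; rewrite addrC addKr dotZr -enorm_sqr n1; nra.
Qed.

(* The ball of radius [rho] tangent at [q] has second-order contact with its
   supporting half-space. *)
Lemma tangent_ball_dist rho q n p : 0 < rho -> enorm n = 1 ->
  dot n (p - q) <= 0 ->
  exists2 w, eball (q - rho *: n) rho w &
             enorm (w - p) <= enorm (p - q) ^+ 2 / (2 * rho).
Proof.
move=> rho0 n1 np; set o := q - _; set r := enorm (p - o).
have r_le : r ^+ 2 <= rho ^+ 2 + enorm (p - q) ^+ 2.
  have -> : r = enorm (p - q + rho *: n) by rewrite /r /o opprB addrA addrAC.
  have := enorm_sqr n; rewrite n1 !enorm_sqr; move: np.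
  move: (p - q) => v np nn.
  rewrite !dotE (dotC v n) -nn; nra.
have r0 : 0 <= r := enorm_ge0 _.
have [rle|rgt] := leP r rho.
  exists p; first by rewrite /eball /closed_ball_ /= enormB.
  rewrite subrr -(scale0r 0) enormZ// mul0r.
  by rewrite divr_ge0// ?sqr_ge0// mulr_ge0// ltW.
have rn0 : 0 < r by lra.
(* The radial projection of [p] onto the sphere; its distance [r - rho] to [p] is at most
   [(r^2 - rho^2) / (2 rho)], as [r + rho >= 2 rho]. *)
exists (o + (rho / r) *: (p - o)).
  rewrite /eball /closed_ball_ /= opprD addNKr enormN enormZ ?divr_ge0 ?(ltW rho0)//.
  by rewrite -/r divfK// gt_eqF.
have -> : o + (rho / r) *: (p - o) - p = - ((1 - rho / r) *: (p - o)).
  by apply/rowP => i; rewrite !mxE; ring.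
have rr1 : rho / r <= 1 by rewrite ler_pdivrMr// mul1r ltW.
rewrite enormN enormZ ?subr_ge0// -/r mulrBl mul1r divfK ?gt_eqF//.
by rewrite ler_pdivlMr ?mulr_gt0//; nra.
Qed.

Lemma halfspace_closed n q : closed [set z | dot n (z - q) <= 0].
Proof.
rewrite [X in closed X](_ : _ = dot n @^-1` [set r | r <= dot n q]).
  apply: preimage_closed; last exact: closed_le.
  by move=> z _; exact: dot_continuous.
by apply/seteqP; split => z /=; rewrite dotDr dotNr subr_le0.
Qed.

Lemma dist_sqr_le_double (x q p : 'rV[R]_d) :
  enorm (p - x) ^+ 2 <= 2 * enorm (q - p) ^+ 2 + 2 * enorm (q - x) ^+ 2.
Proof.
have -> : p - x = (q - x) - (q - p) by rewrite opprB [RHS]addrC addrA subrK.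
rewrite !enorm_sqr; move: (q - x) (q - p) => u v.
by have := dot_ge0 (u + v); rewrite !dotE (dotC v u); lra.
Qed.

(** The length bound has a factor 2 because projecting onto the inner ball need not keep the point
    within [s] of [x]. The last term is the price of that projection. *)
Lemma local_oracle_spec rho s K x c gradient tangent lmo
    (p := result (run gradient tangent (local_oracle rho lmo x s c))) :
  0 < rho -> 0 <= s -> smooth_body rho K -> exact_tangent K tangent ->
  linear_minimizer lmo -> K x ->
  [/\ K p, enorm (p - x) ^+ 2 <= 2 * s ^+ 2 &
      forall z, K z -> enorm (z - x) <= s ->
        dot c p <= dot c z + enorm c * (s ^+ 2 / (2 * rho))].
Proof.
move=> rho0 s0 [_ Ksmooth] tangentP lmoP Kx.
have err0 : 0 <= enorm c * (s ^+ 2 / (2 * rho)).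
  by rewrite mulr_ge0 ?enorm_ge0// divr_ge0 ?sqr_ge0// mulr_ge0// ltW.
rewrite {}/p /local_oracle; have [c0|c0] := eqVneq c 0.
  split=> [//||z _ _] /=.
    by rewrite subrr enorm_sqr -(scale0r 0) dotZl mul0r mulr_ge0 ?sqr_ge0.
  by rewrite -lerBlDl (le_trans _ err0)// c0 -(scale0r 0) !dotZl !mul0r subrr.
have e0 := enorm_gt0 c0; rewrite /=.
have [[[[t t01 tq] Kq] _] normalP] := tangentP x (x - (s / enorm c) *: c) Kx.
case: (tangent _ _) tq Kq normalP => q n /= tq Kq normalP.
have /andP[t0 t1] : 0 <= t <= 1 by move: t01; rewrite /= in_itv.
have qx : q - x = - ((t * s / enorm c) *: c).
  by rewrite -tq; apply/rowP => i; rewrite !mxE; ring.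
have tauE : enorm (q - x) = t * s.
  rewrite qx enormN enormZ ?divfK ?gt_eqF//.
  by rewrite divr_ge0 ?mulr_ge0// enorm_ge0.
have dot_cq : dot c (q - x) = - (t * s * enorm c).
  by rewrite qx dotNr dotZr -enorm_sqr; field; rewrite gt_eqF.
(* A full step minimizes the linear form over the whole ball, by Cauchy-Schwarz. *)
have [taus|taus] := eqVneq (enorm (q - x)) s.
  split=> [//||z _ zx] /=; first by rewrite taus; nra.
  rewrite -lerBlDl (le_trans _ err0)// -dotNr -dotDr.
  have -> : q - z = (q - x) + (x - z) by rewrite addrA subrK.
  rewrite dotDr dot_cq -tauE taus.
  have := cauchy_schwarz c (x - z); rewrite (enormB x) => cs.
  by have := ler_wpM2l (ltW e0) zx; lra.
(* The oracle tests [tau], whereas a normal is promised only when [q] is not the endpoint; reaching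
   the endpoint would force [tau = s]. *)
have qy : q <> x - (s / enorm c) *: c.
  move=> qy; case/eqP: taus; rewrite qy addrC addKr enormN enormZ ?divfK ?gt_eqF//.
  by rewrite divr_ge0// enorm_ge0.
have [n1 nK] := normalP qy.
have ball_sub := Ksmooth _ _ (outward_normal_boundary Kq (conj n1 nK)) (conj n1 nK).
set S := _ `&` _.
have [[p0x np0] p0min] : argmin S (dot c) (lmo c S).
  apply/lmoP/compact_argmin.
  - exists x; split; last exact: nK.
    by rewrite /eball /closed_ball_ /= subrr -(scale0r 0) enormZ// mul0r.
  - apply: (subclosed_compact _ (@eball_compact _ _ x s)) => [|z []//].
    by apply: closedI; [exact: eball_closed|exact: halfspace_closed].
  - exact: dot_continuous.
set p0 := lmo c S in p0x np0 p0min *.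
have [pB pproj] := @ball_projection _ _ (q - rho *: n) _ p0 (ltW rho0).
set p := Defs.proj _ _ in pB pproj *.
have Sq : S q.
  split; last by rewrite /= subrr -(scale0r 0) dotZr mul0r.
  by rewrite /eball /closed_ball_ /= enormB tauE ler_piMl.
(* [q - x] is a negative multiple of [c], so minimality of [p0] against [q]
   makes the angle at [q] in the triangle [x q p0] obtuse. *)
have p0q : enorm (p0 - q) ^+ 2 <= s ^+ 2 - enorm (q - x) ^+ 2.
  have p0q_obtuse : dot (q - x) (p0 - q) >= 0.
    rewrite qx dotNl dotZl -mulrN mulr_ge0 ?divr_ge0 ?mulr_ge0 ?enorm_ge0//.
    by rewrite -dotNr opprB dotDr dotNr subr_ge0 p0min.
  have : enorm (p0 - x) ^+ 2 <= s ^+ 2.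
    by rewrite ler_pXn2r ?nnegrE ?enorm_ge0// enormB.
  have -> : p0 - x = (p0 - q) + (q - x) by rewrite addrA subrK.
  move: p0q_obtuse; rewrite !enorm_sqr; move: (p0 - q) (q - x) => u v.
  by rewrite dotDl !dotDr (dotC u v); lra.
split=> [||z Kz zx].
- exact: ball_sub.
(* Since [q] lies in the inner ball, [|q - p|^2 <= s^2 - tau^2]; with [|q - x| = tau] this sums to
   [2 s^2]. *)
- have : eball (q - rho *: n) rho q.
    rewrite /eball /closed_ball_ /= addrAC subrr add0r enormN.
    by rewrite enormZ ?(ltW rho0)// n1 mulr1.
  move=> /pproj; have := dist_sqr_le_double x q p.
  by have := sqr_ge0 (enorm (p0 - p)); lra.
- have [w wB wp0] := tangent_ball_dist rho0 n1 np0.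
  (* The projection [p] is at least as close to [p0] as the explicit point [w]. *)
  have pp0 : enorm (p - p0) <= s ^+ 2 / (2 * rho).
    apply: (@le_trans _ _ (enorm (w - p0))).
      rewrite -(@ler_pXn2r _ 2) ?nnegrE ?enorm_ge0//.
      have := pproj _ wB; rewrite (enormB p0 w) (enormB p0 p).
      by have := sqr_ge0 (enorm (w - p)); lra.
    apply: le_trans wp0 _; rewrite ler_pM2r ?invr_gt0 ?mulr_gt0//.
    by have := sqr_ge0 (enorm (q - x)); lra.
  have : dot c p0 <= dot c z.
    by apply: p0min; split; [rewrite /eball /closed_ball_ /= enormB|exact: nK].
  have := cauchy_schwarz c (p - p0); rewrite dotDr dotNr.
  by have := ler_wpM2l (ltW e0) pp0; lra.
Qed.

End LocalOracle.

(** Separates the oracle call from the averaging step that follows it in an iteration. *)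
Lemma result_run_bind (V A B : Type) gradient tangent (m : program V A)
    (h : A -> program V B) :
  result (run gradient tangent (bind m h)) =
  result (run gradient tangent (h (result (run gradient tangent m)))).
Proof.
elim: m => [//|x k IHk|x y k IHk] /=.
  have := IHk (gradient x); case: (run _ _ (bind _ _)) => /= r ? ? ->.
  by case: (run gradient tangent (k _)).
have := IHk (tangent x y); case: (run _ _ (bind _ _)) => /= r ? ? ->.
by case: (run gradient tangent (k _)).
Qed.

(** * Contraction of the gap in one iteration *)

Section Iteration.
Variables (R : realType) (d : nat) (alpha beta rho G D H0 : R).
Variables (K : set 'rV[R]_d) (f : 'rV[R]_d -> R) (xstar : 'rV[R]_d).
Hypotheses (alpha_gt0 : 0 < alpha) (beta_gt0 : 0 < beta) (rho_gt0 : 0 < rho).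
Hypothesis G_ge0 : 0 <= G.

Let b := 2 / rho * G / alpha.
Let kappa := beta / alpha.
Local Notation theta := (Defs.theta alpha rho G).
Local Notation eta := (Defs.eta alpha beta rho G).
Local Notation sigma := (Defs.sigma alpha beta rho G).

Let b_ge0 : 0 <= b.
Proof. by rewrite !mulr_ge0// ?invr_ge0 ltW. Qed.

Let kappa_gt0 : 0 < kappa.
Proof. exact: divr_gt0. Qed.

Lemma theta_itv : 0 < theta <= 1.
Proof.
rewrite /Defs.theta -/b divr_gt0//=; last by have := b_ge0; lra.
by rewrite ler_pdivrMr; have := b_ge0; lra.
Qed.

Lemma eta_itv : 0 < eta <= 1.
Proof.
rewrite /Defs.eta -/b -/kappa; have := b_ge0; have := kappa_gt0 => k0 b0.
by rewrite divr_gt0 ?ler_pdivrMr; lra.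
Qed.

Lemma sigma_itv : 0 < sigma < 1.
Proof.
rewrite /Defs.sigma -/b -/kappa; have := b_ge0; have := kappa_gt0 => k0 b0.
by rewrite divr_gt0 ?ltr_pdivrMr; lra.
Qed.

(** The three relations control, in order, the gain of a step, the projection error and the
    curvature term. *)
Lemma parameter_balance :
  [/\ eta * theta = 4 * sigma, b * theta <= 4^-1 & kappa * (eta * theta) <= 4^-1].
Proof.
rewrite /Defs.sigma /Defs.eta /Defs.theta -/b -/kappa.
have := b_ge0; have := kappa_gt0 => k0 b0.
have etE : (1 + b) / (1 + b + kappa) * (1 / (4 * (1 + b))) =
           4 * (1 / (16 * (1 + b + kappa))).
  by field; rewrite !gt_eqF//; lra.
split=> //; first by rewrite mul1r ler_pdivrMr; lra.
rewrite etE (_ : _ * _ = kappa / (4 * (1 + b + kappa))).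
  by rewrite ler_pdivrMr; lra.
by field; rewrite gt_eqF//; lra.
Qed.

Hypothesis Ksmooth : smooth_body rho K.
Hypothesis Kdiam : forall x y, K x -> K y -> enorm (x - y) <= D.
Hypothesis fsmooth : smooth_on beta K f.
Hypothesis fconv : strongly_convex_on alpha K f.
Hypothesis xstar_min : argmin K f xstar.
Hypothesis gradG : forall x, K x -> enorm (grad f x) <= G.

Let segmentK : segment_closed K.
Proof. by case: Ksmooth => -[_ cK _] _; exact: convex_segment. Qed.

(** The radius depends on a bound [h] and not on the true gap, so the estimate is made in terms of
    [h], as the recursion for [Delta] requires. *)
Lemma local_progress h s x p : K x -> f x - f xstar <= h ->
  s = Num.min D (theta * Num.sqrt (2 * h / alpha)) ->
  K p -> enorm (p - x) ^+ 2 <= 2 * s ^+ 2 ->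
  (forall z, K z -> enorm (z - x) <= s ->
     dot (grad f x) p <= dot (grad f x) z
                         + enorm (grad f x) * (s ^+ 2 / (2 * rho))) ->
  K (x + eta *: (p - x)) /\
  f (x + eta *: (p - x)) - f xstar <= (1 - sigma) * h.
Proof.
move=> Kx xh sE Kp px pmin.
have Kxs := xstar_min.1; have fx_ge := xstar_min.2 _ Kx.
have h0 : 0 <= h by lra.
have [/andP[th0 th1] /andP[et0 et1]] := (theta_itv, eta_itv).
have Ky : K (x + eta *: (p - x)) by apply: segmentK => //; rewrite et1 ltW.
split=> //.
set g := grad f x in pmin *.
have ha0 : 0 <= 2 * h / alpha by rewrite divr_ge0 ?mulr_ge0// ltW.
have D0 : 0 <= D := le_trans (enorm_ge0 _) (Kdiam Kx Kx).
have b0 : 0 <= b := b_ge0.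
have s0 : 0 <= s by rewrite sE le_min D0 mulr_ge0 ?sqrtr_ge0// ltW.
have s_le : alpha * s ^+ 2 <= theta ^+ 2 * (2 * h).
  have : s <= theta * Num.sqrt (2 * h / alpha) by rewrite sE ge_min lexx orbT.
  rewrite -(@ler_pXn2r _ 2) ?nnegrE//; last first.
    by apply: mulr_ge0; [exact: ltW|exact: sqrtr_ge0].
  rewrite exprMn sqr_sqrtr// -(ler_pM2l alpha_gt0).
  by rewrite [leRHS](_ : _ = theta ^+ 2 * (2 * h))//; field; rewrite gt_eqF.
have growth := strongly_convex_growth segmentK fconv xstar_min Kx.
have dist_xs : enorm (xstar - x) <= Num.sqrt (2 * h / alpha).
  rewrite enorm_le ?sqrtr_ge0// sqr_sqrtr// ler_pdivlMr// -enorm_sqr enormB.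
  by move: growth; lra.
have g_le : dot g (p - x) <= - theta * (f x - f xstar) + G * (s ^+ 2 / (2 * rho)).
  have Kz : K (x + theta *: (xstar - x)).
    by apply: segmentK => //; rewrite th1 ltW.
  have zx : enorm (x + theta *: (xstar - x) - x) <= s.
    (* The bound by [D] follows from the diameter and [theta <= 1]. *)
    rewrite addrC addKr enormZ ?(ltW th0)// sE le_min ler_pM2l// dist_xs andbT.
    by apply: le_trans (Kdiam Kxs Kx); rewrite ler_piMl ?enorm_ge0.
  have := pmin _ Kz zx; have := fconv Kx Kxs; rewrite -/g.
  have err : enorm g * (s ^+ 2 / (2 * rho)) <= G * (s ^+ 2 / (2 * rho)).
    by rewrite ler_wpM2r ?gradG// divr_ge0 ?sqr_ge0// mulr_ge0// ltW.
  have conv0 : 0 <= alpha / 2 * enorm (xstar - x) ^+ 2.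
    by rewrite mulr_ge0 ?sqr_ge0// divr_ge0// ltW.
  rewrite [dot g (p - x)]dotDr [dot g (- x)]dotNr.
  rewrite [dot g (x + _)]dotDr dotZr; nra.
(* The constant [beta / 2 * (1 + 1 / 4)] is just small enough for [sigma]. *)
have descent := smooth_descent segmentK 2 (ltW alpha_gt0) fconv fsmooth Kx Ky.
have yx : x + eta *: (p - x) - x = eta *: (p - x) by rewrite addrC addKr.
move: descent; rewrite yx -/g dotZr enormZ ?(ltW et0)// exprMn => descent.
have [balance b_th kappa_et] := parameter_balance.
have Gs : G * (s ^+ 2 / (2 * rho)) <= theta / 8 * h.
  rewrite (_ : _ * _ = b / 4 * (alpha * s ^+ 2)); last first.
    by rewrite /b; field; rewrite !gt_eqF.
  apply: (@le_trans _ _ (b / 4 * (theta ^+ 2 * (2 * h)))).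
    by rewrite ler_wpM2l//; apply: (divr_ge0 b0).
  rewrite (_ : _ * _ = (b * theta) * (theta * h / 2)); last by field.
  rewrite (_ : theta / 8 * h = 4^-1 * (theta * h / 2)); last by field.
  by apply: ler_wpM2r => //; rewrite divr_ge0// mulr_ge0// ltW.
(* From [|p - x|^2 <= 2 s^2] and [alpha s^2 <= 2 theta^2 h]; the resulting factor 4 is cancelled by
   [kappa_et]. *)
have px_le : beta * eta ^+ 2 * enorm (p - x) ^+ 2 <= eta * theta * h.
  apply: (@le_trans _ _ (kappa * eta ^+ 2 * (2 * (theta ^+ 2 * (2 * h))))).
    rewrite (_ : beta * _ * _ = kappa * eta ^+ 2 * (alpha * enorm (p - x) ^+ 2)).
      apply: ler_wpM2l; first by rewrite mulr_ge0 ?sqr_ge0// ltW// kappa_gt0.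
      by have := ler_wpM2l (ltW alpha_gt0) px; lra.
    by rewrite /kappa; field; rewrite gt_eqF.
  rewrite (_ : kappa * _ * _ = kappa * (eta * theta) * (4 * (eta * theta * h)));
    last by ring.
  rewrite [leRHS](_ : _ = 4^-1 * (4 * (eta * theta * h))); last by field.
  apply: ler_wpM2r kappa_et; apply: mulr_ge0 => //.
  by apply: mulr_ge0 => //; apply: mulr_ge0; exact: ltW.
have := ler_wpM2l (ltW et0) g_le; have := ler_wpM2l (ltW et0) Gs.
have : 0 <= (1 - eta * theta) * (h - (f x - f xstar)).
  by rewrite mulr_ge0// subr_ge0// mulr_ile1// ltW.
(* Of the gain [eta * theta * h], the projection error uses 1/8 and the curvature term 5/8; the
   remaining quarter is [sigma * h]. *)
have sigmaE : sigma = eta * theta / 4 by lra.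
rewrite sigmaE; lra.
Qed.

Local Notation Delta := (Defs.Delta alpha beta rho G H0).
Local Notation radius := (Defs.radius alpha beta rho G D H0).

Lemma iteration_progress t x tangent lmo
    (y := result (run (grad f) tangent
            (iteration alpha beta rho G D H0 lmo t x))) :
  exact_tangent K tangent -> linear_minimizer lmo ->
  K x -> f x - f xstar <= Delta t ->
  K y /\ f y - f xstar <= Delta t.+1.
Proof.
move=> tangentP lmoP Kx xt.
have D0 : 0 <= D := le_trans (enorm_ge0 _) (Kdiam Kx Kx).
have radius0 : 0 <= radius t.
  by rewrite le_min D0 mulr_ge0 ?sqrtr_ge0//; have /andP[/ltW] := theta_itv.
have [] := @local_oracle_spec _ _ rho (radius t) K x (grad f x) (grad f) tangent
             lmo rho_gt0 radius0 Ksmooth tangentP lmoP Kx.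
rewrite {}/y /=.
have := result_run_bind (grad f) tangent
  (local_oracle rho lmo x (radius t) (grad f x))
  (fun p => Return 'rV_d (x + eta *: (p - x))).
case: (run _ _ (bind _ _)) => /= _ ? ? -> Kp px pmin.
by rewrite /Defs.Delta exprS -mulrA; apply: local_progress xt _ Kp px pmin.
Qed.

Lemma iterate_progress tangent lmo x0 t :
  (forall t, exact_tangent K (tangent t)) ->
  (forall t, linear_minimizer (lmo t)) ->
  K x0 -> f x0 - f xstar <= H0 ->
  let x := iterate alpha beta rho G D H0 f tangent lmo x0 in
  K (x t) /\ f (x t) - f xstar <= Delta t.
Proof.
move=> tangentP lmoP Kx0 x0H; elim: t => [|t [Kx xt]] /=.
  by rewrite /Defs.Delta expr0 mul1r.
exact: iteration_progress.
Qed.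

End Iteration.

(** * Query counts and the number of iterations *)

Lemma iteration_counts (R : realType) (d : nat) (alpha beta rho G D H0 : R)
    (gradient : 'rV[R]_d -> 'rV[R]_d) tangent lmo t x
    (o := run gradient tangent (iteration alpha beta rho G D H0 lmo t x)) :
  gradient_count o = 1%N /\ (tangent_count o <= 1)%N.
Proof.
rewrite {}/o /= /local_oracle; case: (_ == 0) => //=.
by case: (tangent _ _) => q n /=; case: (_ == _).
Qed.

(** This is [1 - s <= expR (- s)] raised to the power [T]; [s <= 1] keeps the base nonnegative. *)
Lemma geometric_le_expR (R : realType) (s : R) (T : nat) : s <= 1 ->
  (1 - s) ^+ T <= expR (- (T%:R * s)).
Proof.
move=> s1; rewrite -mulrN expRM_natl lerXn2r ?nnegrE ?expR_ge0 ?subr_ge0//.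
exact: expR_ge1Dx.
Qed.

Theorem theorem2p1 (R : realType) :
  exists C : R, 0 < C /\
  forall (d : nat) (rho alpha beta G D H0 : R) (K : set 'rV[R]_d)
    (f : 'rV[R]_d -> R) (xstar x0 : 'rV[R]_d),
  0 < rho -> 0 < alpha -> 0 < beta ->
  smooth_body rho K ->
  (diam K <= D%:E)%E ->
  differentiable_near f K ->
  smooth_on beta K f ->
  strongly_convex_on alpha K f ->
  argmin K f xstar ->
  K x0 ->
  f x0 - f xstar <= H0 ->
  (ereal_sup [set (enorm (grad f x))%:E | x in K] <= G%:E)%E ->
  let gamma := alpha / beta in
  let Gamma := G / (alpha * rho) in
  forall eps : R, 0 < eps -> eps < H0 ->
  exists T : nat,
    [/\ (1 <= T)%N,
        T%:Z <= Num.ceil (C * (gamma^-1 + Gamma) * ln (H0 / eps)) &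
        forall (tangent : nat -> 'rV[R]_d -> 'rV[R]_d -> 'rV[R]_d * 'rV[R]_d)
          (lmo : nat -> 'rV[R]_d -> set 'rV[R]_d -> 'rV[R]_d),
        (forall t, exact_tangent K (tangent t)) ->
        (forall t, linear_minimizer (lmo t)) ->
        let x := iterate alpha beta rho G D H0 f tangent lmo x0 in
        let outcome_of :=
          iteration_outcome alpha beta rho G D H0 f tangent lmo x0 in
        [/\ K (x T),
            f (x T) - f xstar <= eps &
            forall t, (t < T)%N ->
              gradient_count (outcome_of t) = 1%N /\
              (tangent_count (outcome_of t) <= 1)%N]].
Proof.
(* With [b = 2 Gamma] and [1 <= kappa], [1 / sigma = 16 (1 + 2 Gamma + kappa) <= 32 (kappa +
   Gamma)]. *)
exists 32; split=> // d rho alpha beta G D H0 K f xstar x0.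
move=> rho0 alpha0 beta0 Ksmooth Kdiam _ fsmooth fconv xsmin Kx0 x0H KG.
move=> gamma Gamma eps eps0 epsH.
have diamK x y : K x -> K y -> enorm (x - y) <= D.
  move=> Kx Ky; rewrite -lee_fin; apply: le_trans Kdiam.
  by apply: ereal_sup_ubound; exists (x, y).
have gradG x : K x -> enorm (grad f x) <= G.
  move=> Kx; rewrite -lee_fin; apply: le_trans KG.
  by apply: ereal_sup_ubound; exists x.
have G0 : 0 <= G := le_trans (enorm_ge0 _) (gradG _ Kx0).
have H00 : 0 < H0 by lra.
have L0 : 0 < ln (H0 / eps) by rewrite ln_gt0// ltr_pdivlMr// mul1r.
have kappa0 : 0 < gamma^-1 by rewrite invr_gt0 divr_gt0.
have Gamma0 : 0 <= Gamma by rewrite divr_ge0// mulr_ge0// ltW.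
have progress := iterate_progress alpha0 beta0 rho0 G0 Ksmooth diamK fsmooth
                   fconv xsmin gradG.
have [ba|ab] := ltP beta alpha.
  have single x y := singleton_of_conditioning fconv fsmooth ba (x := x) (y := y).
  (* Every iterate equals [xstar], and 1 is allowed because the ceiling of a positive number is at
     least 1. *)
  exists 1%N; split=> // [|tangent lmo tangentP lmoP x outcome_of].
    by rewrite -gtz0_ge1 ceil_gt0 !mulr_gt0// ltr_wpDr.
  have [Kx1 _] := progress _ _ _ _ 1%N tangentP lmoP Kx0 x0H.
  split=> // [|t _]; last exact: iteration_counts.
  by rewrite (single (x 1%N) _ Kx1 xsmin.1) subrr ltW.
have /andP[sg0 sg1] := sigma_itv alpha0 beta0 rho0 G0.
set sg := sigma _ _ _ _ in sg0 sg1.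
(* The least [T] with [expR (- (T * sg)) <= eps / H0]; the absolute value only converts a positive
   integer to [nat]. *)
pose T := `|Num.ceil (ln (H0 / eps) / sg)|%N.
have quot0 : 0 < ln (H0 / eps) / sg by rewrite divr_gt0.
have TE : T%:Z = Num.ceil (ln (H0 / eps) / sg).
  by rewrite gez0_abs// ltW// ceil_gt0.
exists T; split=> [||tangent lmo tangentP lmoP x outcome_of].
- by rewrite -ltz_nat TE ceil_gt0.
- rewrite TE le_ceil_tmp// mulrC ler_wpM2r ?(ltW L0)//.
  have kappa_ge1 : 1 <= beta / alpha by rewrite ler_pdivlMr// mul1r.
  rewrite /sg /sigma div1r invrK.
  have -> : gamma^-1 = beta / alpha by rewrite invf_div.
  have -> : 2 / rho * G / alpha = 2 * Gamma.
    by rewrite /Gamma; field; rewrite !gt_eqF.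
  by lra.
have [KxT xT] := progress _ _ _ _ T tangentP lmoP Kx0 x0H.
split=> // [|t _]; last exact: iteration_counts.
apply: le_trans xT _; rewrite /Delta -/sg.
rewrite -ler_pdivlMr//; apply: le_trans (geometric_le_expR _ (ltW sg1)) _.
have -> : eps / H0 = expR (- ln (H0 / eps)).
  by rewrite expRN lnK ?posrE ?divr_gt0// invf_div.
rewrite ler_expR lerN2 -ler_pdivrMr//.
by rewrite -[T%:R]/(T%:Z%:~R) TE ceil_ge.
Qed.
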